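(* 1. Let $q>1$ be a prime power and $\alpha\in\mathbb{F}_q^{\star}$. Then $x^{q-1}-\alpha$ is irreducible over $\mathbb{F}_q$ if and only if $\alpha$ generates the group $\mathbb{F}_q^{\star}$. 2. Suppose that $q=2^m$, where $m\geq 2$ is an integer. Then the following conditions are equivalent: (i) for every $\alpha\in\mathbb{F}_q\setminus\{0,1\}$, $x^{q-1}-\alpha$ is stable over $\mathbb{F}_q$; (ii) for every $\alpha\in\mathbb{F}_q\setminus\{0,1\}$, $x^{q-1}-\alpha$ is irreducible over $\mathbb{F}_q$; (iii) $q-1$ is a Mersenne prime.
   Context: $\mathbb{F}_q$ is the finite field with $q$ elements and $\mathbb{F}_q^{\star}$ its multiplicative group. The iterates of a polynomial $f$ are $f_0(x)=x$, $f_1(x)=f(x)$, $f_n(x)=f_{n-1}(f(x))$ for $n\geq 2$; $f$ is stable over a field $K$ if $f_n(x)$ is irreducible over $K$ for all $n\ge 0$. A Mersenne number is a positive integer of the form $2^m-1$ with $m\geq 2$ an integer; a Mersenne prime is a Mersenne number that is prime. *)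

(* Defs.v *)
From mathcomp Require Import all_boot all_algebra.

Set Implicit Arguments.
Unset Strict Implicit.
Unset Printing Implicit Defensive.

Import GRing.Theory.
Local Open Scope ring_scope.

Fixpoint iter_poly (R : comNzRingType) (f : {poly R}) (n : nat) : {poly R} :=
  if n is n'.+1 then iter_poly f n' \Po f else 'X.

Definition stable_poly (K : fieldType) (f : {poly K}) : Prop :=
  forall n : nat, irreducible_poly (iter_poly f n).

Definition mersenne_number (n : nat) : Prop :=
  exists2 m : nat, (2 <= m)%N & n = (2 ^ m - 1)%N.

Definition mersenne_prime (n : nat) : Prop := mersenne_number n /\ prime n.

(* Main.v *)
Require Import Defs.
From mathcomp Require Import all_boot all_algebra all_fingroup cyclic.
From mathcomp Require Import pgroup abelian finfield qfpoly.

Import GRing.Theory.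
Local Open Scope ring_scope.

(** Write q for the order of the finite field F and r = q - 1. Both parts rest
    on one criterion: if g is monic irreducible of degree d over F and
    c = (-1)^d g(0), the norm of a root of g, is a primitive r-th root of unity,
    then g(X^r) is irreducible ([irreducible_comp_Xr]).

    To see this, let y be a root of g. The product of its conjugates y^(q^i),
    i < d, is c, so g divides X^(1 + q + ... + q^(d-1)) - c
    ([irreducible_dvd_norm]). Let p be an irreducible factor of g(X^r), of
    degree k. As r (1 + q + ... + q^(d-1)) = q^d - 1, substituting X^r gives
    X^(q^d) = c X modulo p: the d-th power of Frobenius multiplies the class of
    X by c, and its j-th iterate multiplies it by c^j ([twist_iter]). On the
    other hand X^(q^k) = X modulo p, since the residue field of p has q^k
    elements; the same holds for the class of X^r, which is a root of g, so
    d divides k ([irreducible_dvd_XqnX]). With k = j d this forces c^j = 1, so r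
    divides j and k >= r d, the degree of g(X^r): there is no proper factor.

    For the first part take g = X - alpha, whose c is alpha itself. Conversely,
    if alpha has order n and X^r - alpha is irreducible, the same twisting shows
    that it divides X^(q^n) - X, so its degree r divides n.

    For the second part, irreducibility for all alpha other than 0 and 1 means
    that every nontrivial element of the group of units generates it, so by
    Cauchy its order q - 1 is prime. Conversely let q - 1 be prime, so that every
    element other than 0 and 1 is a primitive r-th root of unity, and put
    f = X^r - alpha. Then f_(n+1) = f_n(X^r - alpha) = g(X^r) for
    g = f_n(X - alpha), and g(0) = f_n(-alpha) = f_n(alpha) in characteristic 2,
    where signs do not matter. Since f takes the constant value 1 - alpha on
    nonzero elements, the orbit of alpha under f avoids 0 and 1
    ([iter_neq01]), and the criterion applies at each step. *)

(** * Residue fields and the Frobenius map *)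

(** The residue field F[X]/(p), where y is the class of X: p is the minimal
    polynomial of y, and y generates the field over F. *)
Lemma adjoin_root (F : finFieldType) (p : {poly F}) :
  irreducible_poly p -> p \is monic ->
  exists (L : finFieldType) (iota : {rmorphism F -> L}) (y : L),
    [/\ #|L| = (#|F| ^ (size p).-1)%N,
        forall s, (p %| s) = root (map_poly iota s) y
      & forall z, exists s, z = (map_poly iota s).[y]].
Proof.
move=> p_irr p_mon.
have hI : monic_irreducible_poly p by [].
exists {poly %/ p with hI}, (qpolyC p : {rmorphism F -> {poly %/ p with hI}}).
have evalE s : (map_poly (qpolyC p) s).['qX] = in_qpoly p s.
  by rewrite -in_qpoly_comp_horner comp_polyXr.
exists ('qX : {poly %/ p with hI}); split=> [|s|z].
- by rewrite card_qfpoly.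
- rewrite rootE evalE -val_eqE /= /in_qpoly /= mk_monicE //.
  by rewrite -Pdiv.IdomainMonic.modpE.
exists (val z); rewrite evalE; apply/val_inj => /=.
by rewrite Pdiv.Ring.rmodp_small ?size_mk_monic.
Qed.

(** Raising to the power q is additive, since q is a power of the
    characteristic, and it fixes the coefficients. *)
Lemma exp_card_comp (F : finFieldType) (s : {poly F}) n :
  s ^+ (#|F| ^ n) = s \Po 'X^(#|F| ^ n).
Proof.
suff base (t : {poly F}) : t ^+ #|F| = t \Po 'X^#|F|.
  elim: n => [|n IHn]; first by rewrite expn0 expr1 comp_polyXr.
  rewrite expnSr exprM IHn base -comp_polyA comp_Xn_poly.
  by congr (_ \Po _); rewrite -exprM mulnC.
have [p p_pr pchF] := finPcharP F.
have qnat : [pchar {poly F}].-nat #|F|.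
  have /abelem_pgroup := fin_lmod_pchar_abelem F^o pchF.
  rewrite /pgroup cardsT; apply: sub_in_pnat => r _ /eqP->.
  by rewrite pchar_poly.
elim/poly_ind: t => [|t c IHt].
  by rewrite comp_poly0 expr0n -[_ == _]negbK -lt0n (ltnW (finNzRing_gt1 _)).
rewrite exprDn_pchar // exprMn IHt -polyC_exp expf_card.
by rewrite comp_polyD comp_polyM comp_polyX comp_polyC.
Qed.

(** The class y of X satisfies y^(q^d) = y, where d is the degree of p. Reducing
    n modulo d leaves an exponent b < d; if y is fixed by z |-> z^(q^b), so is the
    whole residue field, whose q^d elements are too many roots for
    X^(q^b) - X unless b = 0. *)
Lemma irreducible_dvd_XqnX (F : finFieldType) (p : {poly F}) n :
  irreducible_poly p -> p \is monic ->
  (p %| 'X^(#|F| ^ n) - 'X) = ((size p).-1 %| n)%N.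
Proof.
move=> p_irr p_mon; have [L [iota [y [cardL dvdE genL]]]] := adjoin_root _ _ p_irr p_mon.
set q := #|F| in cardL *; set d := (size p).-1 in cardL *.
have q_gt1 : (1 < q)%N by apply: finNzRing_gt1.
have d_gt0 : (0 < d)%N by rewrite -ltnS prednK ?p_irr // ltnW ?p_irr.
rewrite dvdE rootE rmorphB /= map_polyXn map_polyX !hornerE subr_eq0.
have yM a : y ^+ (q ^ (a * d)) = y.
  elim: a => [|a IHa]; first by rewrite expr1.
  by rewrite mulSn expnD exprM -cardL expf_card.
rewrite {1}(divn_eq n d) expnD exprM yM /dvdn.
have := ltn_pmod n d_gt0; move: (n %% d)%N => b b_lt_d.
apply/eqP/eqP=> [yb | ->]; last by rewrite expr1.
apply/eqP; rewrite -leqn0 leqNgt; apply/negP=> b_gt0.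
have fixL (z : L) : z ^+ (q ^ b) = z.
  have [s ->] := genL z.
  by rewrite -horner_exp -rmorphXn exp_card_comp /= map_comp_poly map_polyXn
             horner_comp hornerXn yb.
have qb_gt1 : (1 < q ^ b)%N by rewrite -(expn0 q) ltn_exp2l.
have sz : size ('X^(q ^ b) - 'X : {poly L}) = (q ^ b).+1.
  by rewrite size_polyDl size_polyXn // size_polyN size_polyX.
have := @max_poly_roots _ ('X^(q ^ b) - 'X) (enum L).
rewrite -size_poly_eq0 sz -cardE cardL ltnS leqNgt ltn_exp2l // b_lt_d.
move=> roots_le; suff: false by []; apply: roots_le (enum_uniq _) => //.
by apply/allP=> z _; rewrite rootE !hornerE fixL subrr.
Qed.

(** The roots of p in its residue field are the d distinct conjugates y^(q^i) of
    the class y of X, so their product is (-1)^d p(0). *)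
Lemma irreducible_dvd_norm (F : finFieldType) (p : {poly F}) :
  irreducible_poly p -> p \is monic ->
  p %| 'X^(\sum_(i < (size p).-1) #|F| ^ i) - ((-1) ^+ (size p).-1 * p.[0])%:P.
Proof.
move=> p_irr p_mon; have [L [iota [y [_ dvdE _]]]] := adjoin_root _ _ p_irr p_mon.
have fixE n : (y ^+ (#|F| ^ n) == y) = ((size p).-1 %| n)%N.
  rewrite -irreducible_dvd_XqnX // dvdE rootE rmorphB /= map_polyXn map_polyX.
  by rewrite !hornerE subr_eq0.
set q := #|F| in fixE *; set d := (size p).-1 in fixE *.
have q_gt0 : (0 < q)%N by apply: ltnW (finNzRing_gt1 _).
pose rs := [seq y ^+ (q ^ i) | i <- index_iota 0 d].
have fix_d : y ^+ (q ^ d) = y by apply/eqP; rewrite fixE.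
have rs_roots : all (root (map_poly iota p)) rs.
  apply/allP=> _ /mapP[i _ ->]; rewrite rootE.
  have : p %| p \Po 'X^(q ^ i) by rewrite -exp_card_comp dvdp_exp // expn_gt0 q_gt0.
  by rewrite dvdE rootE map_comp_poly /= map_polyXn horner_comp hornerXn.
have rs_uniq : uniq rs.
  rewrite map_inj_in_uniq ?iota_uniq // => i j.
  rewrite !mem_index_iota /= => i_lt_d j_lt_d.
  wlog le_ij : i j i_lt_d j_lt_d / (i <= j)%N.
    move=> IH eq_ij; have [ij|/ltnW ji] := leqP i j; first exact: IH.
    by apply/esym/IH.
  (* Apply z |-> z^(q^(d - i)) to both sides of the equality. *)
  move=> eq_ij; have : (d %| j + (d - i))%N.
    by rewrite -fixE expnD exprM -eq_ij -exprM -expnD subnKC ?fix_d // ltnW.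
  rewrite addnBA ?(ltnW i_lt_d) // addnC -addnBA // dvdn_addr // /dvdn.
  rewrite modn_small ?subn_eq0 => [ge_ij|]; last by rewrite ltn_subLR // ltn_addl.
  by apply/eqP; rewrite eqn_leq le_ij.
have /all_roots_prod_XsubC-/(_ rs_roots) : size (map_poly iota p) = (size rs).+1.
  by rewrite size_map_poly size_map size_iota subn0 prednK // ltnW ?p_irr.
rewrite uniq_rootsE rs_uniq lead_coef_map (monicP p_mon) rmorph1 scale1r big_map.
move=> /(_ isT)-p_split.
rewrite dvdE rootE rmorphB /= map_polyXn map_polyC /= !hornerE.
rewrite rmorphM rmorphXn rmorphN1 -horner_map rmorph0 p_split horner_prod big_mkord.
under [X in _ * X]eq_bigr => i _ do rewrite hornerXsubC sub0r.
rewrite prodrN card_ord mulrA -exprMn mulrNN mulr1 expr1n mul1r.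
by rewrite subr_eq0; apply/eqP; elim/big_rec2: _ => [|i u v _ <-]; rewrite ?exprD.
Qed.

(** If the d-th power of Frobenius multiplies the class of X modulo p by a
    constant c, its j-th iterate multiplies it by c^j, because c is fixed by
    Frobenius. *)
Lemma twist_iter (F : finFieldType) (p : {poly F}) (c : F) d j :
  p %| 'X^(#|F| ^ d) - c *: 'X -> p %| 'X^(#|F| ^ (d * j)) - c ^+ j *: 'X.
Proof.
move=> p_dvd; elim: j => [|j IHj]; first by rewrite muln0 expr1 scale1r subrr dvdp0.
pose u : {poly F} := 'X^(#|F| ^ (d * j)) - c ^+ j *: 'X.
have -> : 'X^(#|F| ^ (d * j.+1)) - c ^+ j.+1 *: 'X
          = u ^+ (#|F| ^ d) + c ^+ j *: ('X^(#|F| ^ d) - c *: 'X).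
  rewrite exp_card_comp /u comp_polyB comp_Xn_poly comp_polyZ comp_polyX -exprM.
  by rewrite -expnD -mulnS scalerBr scalerA -exprSr addrA subrK.
rewrite dvdp_add ?dvdp_exp ?expn_gt0 ?(ltnW (finNzRing_gt1 _)) //.
by rewrite -mul_polyC dvdp_mull.
Qed.

(** * The irreducibility criterion *)

Lemma monic_irreducible_factor (F : finFieldType) (h : {poly F}) :
  (1 < size h)%N ->
  exists2 p, irreducible_poly p /\ p \is monic & p %| h.
Proof.
have [n] := ubnP (size h); elim: n h => // n IHn h; rewrite ltnS => szh h_gt1.
have [h_irr | h_red] := boolP (irreducibleb h).
  have /irreducibleP h_irr' := h_irr.
  have lc_neq0 : lead_coef h != 0 by rewrite lead_coef_eq0 irredp_neq0.
  have eq_h : (lead_coef h)^-1 *: h %= h by rewrite eqp_scale ?invr_eq0.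
  exists ((lead_coef h)^-1 *: h); last by rewrite (eqp_dvdl _ eq_h).
  split; last by rewrite monicE lead_coefZ mulVf.
  split=> [|u u_neq1]; first by rewrite (eqp_size eq_h).
  by rewrite (eqp_dvdr _ eq_h) (eqp_rtrans eq_h); apply: h_irr'.
move: h_red; rewrite /irreducibleb h_gt1 negb_forall => /existsP[u].
rewrite negb_imply -ltnNge => /andP[u_dvd u_gt1].
have szu : (size u < n)%N.
  by rewrite (leq_trans _ szh) // (leq_ltn_trans (size_npoly u)) // ltn_predL ltnW.
have [p p_irr p_dvd] := IHn _ szu u_gt1; exists p => //.
by rewrite (dvdp_trans p_dvd) // Pdiv.Idomain.dvdpE.
Qed.

Lemma irreducible_min_factor (F : finFieldType) (h : {poly F}) :
    (1 < size h)%N ->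
    (forall p, irreducible_poly p -> p \is monic -> p %| h -> (size h <= size p)%N) ->
  irreducible_poly h.
Proof.
move=> h_gt1 min_h; split=> // d d_neq1 d_dvd.
have h0 : h != 0 by rewrite -size_poly_gt0 ltnW.
have d0 : d != 0 by apply: contraTneq d_dvd => ->; rewrite dvd0p.
have [|p [p_irr p_mon] p_dvd] := monic_irreducible_factor F d.
  by rewrite ltn_neqAle eq_sym d_neq1 size_poly_gt0.
rewrite -dvdp_size_eqp // eqn_leq dvdp_leq //.
by rewrite (leq_trans (min_h p p_irr p_mon (dvdp_trans p_dvd d_dvd))) ?dvdp_leq.
Qed.

(** The constant (-1)^d g(0) is the norm of a root of g; for d = 1 this is the
    irreducibility of X^(q-1) - c when c generates the group of units. *)
Lemma irreducible_comp_Xr (F : finFieldType) (g : {poly F}) :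
    irreducible_poly g -> g \is monic ->
    (#|F|.-1).-primitive_root ((-1) ^+ (size g).-1 * g.[0]) ->
  irreducible_poly (g \Po 'X^(#|F|.-1)).
Proof.
move=> g_irr g_mon; have := irreducible_dvd_norm _ _ g_irr g_mon.
set q := #|F|; set r := q.-1; set d := (size g).-1; set c := _ * g.[0] => g_dvd c_prim.
have q_gt1 : (1 < q)%N by apply: finNzRing_gt1.
have r_gt0 : (0 < r)%N by rewrite -ltnS prednK // ltnW.
have d_gt0 : (0 < d)%N by rewrite -ltnS prednK ?g_irr // ltnW ?g_irr.
have c_neq0 : c != 0.
  by apply/eqP=> c0; move: (prim_expr_order c_prim); rewrite c0 expr0n
    -[_ == _]negbK -lt0n r_gt0 => /esym/eqP; rewrite oner_eq0.
have szh : (size (g \Po 'X^r)).-1 = (d * r)%N by rewrite size_comp_poly size_polyXn.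
have h_gt1 : (1 < size (g \Po 'X^r))%N.
  by rewrite -subn_gt0 subn1 szh muln_gt0 d_gt0.
apply: irreducible_min_factor => // p p_irr p_mon p_dvd.
have twist : p %| 'X^(q ^ d) - c *: 'X.
  have -> : 'X^(q ^ d) - c *: 'X = ('X^(\sum_(i < d) q ^ i) - c%:P \Po 'X^r) * 'X.
    rewrite comp_polyB comp_Xn_poly comp_polyC mulrBl mul_polyC -exprM -exprSr.
    by congr ('X^_ - _); rewrite -predn_exp prednK // expn_gt0 ltnW.
  by rewrite dvdp_mulr // (dvdp_trans p_dvd) ?dvdp_comp_poly.
set k := (size p).-1.
have p_fix : p %| 'X^(q ^ k) - 'X by rewrite irreducible_dvd_XqnX.
(* Otherwise g and X^(q^k) - X are coprime, and remain so after substituting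
   X^r for X; but then p divides both. *)
have d_dvd_k : (d %| k)%N.
  rewrite -(irreducible_dvd_XqnX _ g) //; apply: contraT => g_ndvd.
  have : coprimep g ('X^(q ^ k) - 'X) by rewrite irreducible_poly_coprime.
  move=> /coprimep_comp_poly-/(_ 'X^r) /coprimepP/(_ p p_dvd).
  rewrite comp_polyB comp_Xn_poly comp_polyX.
  rewrite -size_poly_eq1 gtn_eqF ?p_irr //; apply.
  by rewrite -exprM mulnC exprM; apply: dvdp_trans p_fix _; rewrite subrXX dvdp_mulIl.
have [j def_k] := dvdnP d_dvd_k.
have : p %| (c ^+ j - 1) *: 'X.
  have := twist_iter _ _ _ _ j twist; rewrite mulnC -def_k => twist_k.
  by rewrite scalerBl scale1r -(dvdp_addr _ twist_k) addrA subrK.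
have [cj1 _|cj_neq1] := eqVneq (c ^+ j) 1.
  have : (r %| j)%N by rewrite (prim_order_dvd c_prim) cj1.
  have j_gt0 : (0 < j)%N.
    rewrite lt0n; apply: contraTneq p_irr.1 => j0.
    by move: def_k; rewrite j0 mul0n /k; case: (size p) => [|[]].
  move=> /(dvdn_leq j_gt0) le_rj.
  rewrite -[size p]prednK ?(ltnW p_irr.1) // -/k def_k.
  by rewrite -[size _]prednK ?szh ?(ltnW h_gt1) // ltnS mulnC leq_mul2r le_rj orbT.
(* Here p would be associate to X, so that g(0) = 0. *)
rewrite dvdpZr ?subr_eq0 // => p_X.
have p_eqX : p %= 'X.
  rewrite -dvdp_size_eqp // eqn_leq dvdp_leq ?polyX_eq0 // size_polyX.
  exact: p_irr.1.
have : root (g \Po 'X^r) 0 by rewrite -dvdp_XsubCl subr0 -(eqp_dvdl _ p_eqX).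
rewrite rootE horner_comp hornerXn expr0n -[_ == 0%N]negbK -lt0n r_gt0 /=.
by move=> /eqP g0; move: c_neq0; rewrite /c g0 mulr0 eqxx.
Qed.

(** * Generators of the group of units *)

Lemma expf_pred_card (F : finFieldType) (c : F) : c != 0 -> c ^+ #|F|.-1 = 1.
Proof.
move=> c0; apply: (mulfI c0).
by rewrite -exprS prednK ?expf_card ?mulr1 // ltnW ?finNzRing_gt1.
Qed.

Lemma primitive_root_card_neq01 (F : finFieldType) (c : F) :
  prime #|F|.-1 -> c != 0 -> c != 1 -> (#|F|.-1).-primitive_root c.
Proof.
move=> q_pr c0 c1.
have [n c_prim n_dvd] := prim_order_exists (prime_gt0 q_pr) (expf_pred_card F c c0).
have /primeP[_ n_div] := q_pr; have /orP[/eqP n1|/eqP<-//] := n_div _ n_dvd.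
by case/eqP: c1; rewrite -(prim_expr_order c_prim) n1.
Qed.

Lemma generatorT_primitive (F : finFieldType) (a : {unit F}) :
  generator [set: {unit F}] a = (#|F|.-1).-primitive_root (val a).
Proof.
have exp_a n : (val a ^+ n == 1) = (#[a]%g %| n)%N.
  by rewrite -FinRing.val_unitX -FinRing.val_unit1 (inj_eq val_inj) order_dvdn.
have a_prim : #[a]%g.-primitive_root (val a).
  have [|n a_prim n_dvd] := @prim_order_exists _ #[a]%g (val a) (order_gt0 a).
    by apply/eqP; rewrite exp_a.
  suff -> : #[a]%g = n by [].
  by apply/eqP; rewrite eqn_dvd n_dvd -exp_a (prim_expr_order a_prim) eqxx.
rewrite /generator -card_finField_unit eq_sym eqEcard subsetT /= -orderE.
apply/idP/idP=> [le_ord|prim].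
  suff -> : #|[set: {unit F}]| = #[a]%g by [].
  by apply/eqP; rewrite eqn_leq le_ord subset_leq_card ?subsetT.
apply: dvdn_leq; rewrite ?order_gt0 // (prim_order_dvd prim).
by rewrite exp_a.
Qed.

(** The converse direction uses the order n of a: X^(q-1) - a divides
    X^(q^n) - a^n X = X^(q^n) - X, so if it is irreducible its degree divides
    n. *)
Lemma irreducible_Xr_sub_generator (F : finFieldType) (a : {unit F}) :
  irreducible_poly ('X^(#|F|.-1) - (val a)%:P) <->
  generator [set: {unit F}] a.
Proof.
have q_gt1 := finNzRing_gt1 F.
rewrite generatorT_primitive; split=> [a_irr | a_prim].
  have r_gt0 : (0 < #|F|.-1)%N by rewrite -ltnS prednK // ltnW.
  have a_mon : 'X^(#|F|.-1) - (val a)%:P \is monic by rewrite monicXnsubC.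
  have twist : 'X^(#|F|.-1) - (val a)%:P %| 'X^(#|F| ^ 1) - val a *: 'X.
    by rewrite expn1 -[X in 'X^X - _ *: _]prednK ?(ltnW q_gt1) // exprSr
               -mul_polyC -mulrBl dvdp_mulr.
  rewrite -generatorT_primitive /generator eq_sym eqEcard subsetT /= -orderE.
  rewrite card_finField_unit dvdn_leq ?order_gt0 //.
  have := twist_iter _ _ _ _ #[a]%g twist.
  rewrite mul1n -FinRing.val_unitX expg_order FinRing.val_unit1 scale1r.
  by rewrite irreducible_dvd_XqnX // size_XnsubC.
have -> : 'X^(#|F|.-1) - (val a)%:P = ('X - (val a)%:P) \Po 'X^(#|F|.-1).
  by rewrite comp_polyB comp_polyX comp_polyC.
apply: irreducible_comp_Xr; rewrite ?monicXsubC //; first exact: irredp_XsubC.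
by rewrite size_XsubC /= hornerXsubC sub0r expr1 mulN1r opprK.
Qed.

(** By Cauchy some element has prime order, and it generates the group. *)
Lemma prime_card_of_generators (gT : finGroupType) :
    (1 < #|[set: gT]|)%N -> (forall x : gT, x != 1%g -> generator [set: gT] x) ->
  prime #|[set: gT]|.
Proof.
move=> gt1 gen; have := pdiv_prime gt1; set p := pdiv _ => p_pr.
have [x _ ox] := @Cauchy _ p [set: gT]%G p_pr (pdiv_dvd _).
have /gen/eqP-> : x != 1%g by rewrite -order_eq1 ox gtn_eqF ?prime_gt1.
by rewrite -orderE ox.
Qed.

(** * Stability *)

Lemma irreducible_comp_XsubC (K : fieldType) (g : {poly K}) (a : K) :
  irreducible_poly g -> irreducible_poly (g \Po ('X - a%:P)).
Proof.
move=> g_irr; split=> [|u u_neq1 u_dvd].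
  by rewrite size_comp_poly2 ?size_XsubC ?g_irr.
have shiftK (s : {poly K}) : (s \Po ('X + a%:P)) \Po ('X - a%:P) = s.
  by rewrite -comp_polyA comp_polyD comp_polyX comp_polyC subrK comp_polyXr.
have shiftK' (s : {poly K}) : (s \Po ('X - a%:P)) \Po ('X + a%:P) = s.
  by rewrite -comp_polyA comp_polyB comp_polyX comp_polyC addrK comp_polyXr.
have : u \Po ('X + a%:P) %= g.
  apply: g_irr; first by rewrite size_comp_poly2 // size_XaddC.
  by rewrite -[g]shiftK' dvdp_comp_poly.
by case/andP=> ug gu; rewrite -[u]shiftK /eqp !dvdp_comp_poly.
Qed.

Lemma monic_comp (R : idomainType) (p s : {poly R}) :
  p \is monic -> s \is monic -> (1 < size s)%N -> p \Po s \is monic.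
Proof.
move=> p_mon s_mon s_gt1.
by rewrite monicE lead_coef_comp // (monicP p_mon) (monicP s_mon) expr1n mulr1.
Qed.

(** On nonzero x the power X^(q-1) is 1, so X^(q-1) - a takes the value 1 - a,
    which is again neither 0 nor 1. *)
Lemma iter_neq01 (F : finFieldType) (a x : F) n :
    a != 0 -> a != 1 -> x != 0 -> x != 1 ->
  let y := (iter_poly ('X^(#|F|.-1) - a%:P) n).[x] in (y != 0) && (y != 1).
Proof.
move=> a0 a1 x0 x1 /=; set f := _ - a%:P.
elim: n x x0 x1 => [|n IHn] x x0 x1 /=; first by rewrite hornerX x0.
have fx : f.[x] = 1 - a.
  by rewrite /f !hornerE expf_pred_card.
rewrite horner_comp fx; apply: IHn; first by rewrite subr_eq0 eq_sym.
by rewrite -subr_eq0 addrC addKr oppr_eq0.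
Qed.

Lemma stable_Xr_sub (F : finFieldType) (a : F) :
    2%N \in [pchar F] -> prime #|F|.-1 -> a != 0 -> a != 1 ->
  stable_poly ('X^(#|F|.-1) - a%:P).
Proof.
move=> char2 q_pr a0 a1; set f := _ - a%:P.
have r_gt0 := prime_gt0 q_pr.
(* The criterion needs a monic polynomial, so this is carried along. *)
suff stab n : irreducible_poly (iter_poly f n) /\ iter_poly f n \is monic.
  by move=> n; case: (stab n).
elim: n => [|n [g_irr g_mon]] /=.
  by split; [rewrite -['X]subr0; apply: irredp_XsubC | rewrite monicX].
set g := iter_poly f n in g_irr g_mon *.
have f_dec : f = ('X - a%:P) \Po 'X^(#|F|.-1).
  by rewrite comp_polyB comp_polyX comp_polyC.
split; last first.
  by rewrite monic_comp ?monicXnsubC // size_XnsubC.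
rewrite f_dec comp_polyA; apply: irreducible_comp_Xr.
- exact: irreducible_comp_XsubC.
- by rewrite monic_comp ?monicXsubC // size_XsubC.
(* The norm to consider is +- f_n(-a), that is, f_n(a). *)
rewrite horner_comp hornerXsubC sub0r !(oppr_pchar2 char2) expr1n mul1r.
have /andP[ga0 ga1] := iter_neq01 _ a a n a0 a1 a0 a1.
exact: primitive_root_card_neq01.
Qed.

Theorem theorem4p11 (F : finFieldType) (q : nat) (hq : #|F| = q) :
  (forall alpha : {unit F},
     irreducible_poly ('X^(q - 1) - (val alpha)%:P) <->
     generator [set: {unit F}] alpha)
  /\
  (forall m : nat, (2 <= m)%N -> q = (2 ^ m)%N ->
     [<-> forall alpha : F, alpha != 0 -> alpha != 1 ->
            stable_poly ('X^(q - 1) - alpha%:P);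
          forall alpha : F, alpha != 0 -> alpha != 1 ->
            irreducible_poly ('X^(q - 1) - alpha%:P);
          mersenne_prime (q - 1)%N]).
Proof.
rewrite subn1 -hq; split=> [a|m m_ge2 card2]; first exact: irreducible_Xr_sub_generator.
have char2 : 2%N \in [pchar F] by apply: card_finPcharP card2 _.
tfae=> [stab a a0 a1 | irr | [_ q_pr] a a0 a1].
- by have := stab a a0 a1 1%N; rewrite /= comp_polyX.
- split; first by exists m; rewrite // card2 subn1.
  rewrite -card_finField_unit; apply: prime_card_of_generators => [|x x1].
    rewrite card_finField_unit card2 -ltnS prednK ?expn_gt0 //.
    by rewrite (@leq_trans (2 ^ 2)) // leq_exp2l.
  apply/irreducible_Xr_sub_generator/irr; first by rewrite -unitfE (valP x).
  by rewrite -FinRing.val_unit1 (inj_eq val_inj).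
exact: stable_Xr_sub.
Qed.
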